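(* For an integer $n\ge 1$ let $P_n$ denote the path graph on $n$ vertices, and let $\chi_d^{\min}(P_n)$ be the minimum of $\chi_d(D)$ over all orientations $D$ of $P_n$. Then for every integer $k\geq 1$, \[ \chi_d^{\min}(P_n)=\begin{cases} k+2 & \text{if } n=4k,\\ k+2 & \text{if } n=4k+1,\\ k+3 & \text{if } n=4k+2,\\ k+3 & \text{if } n=4k+3, \end{cases} \] with the single exception $\chi_d^{\min}(P_6)=3$.
   Context: All digraphs are orientations of simple graphs (no loops, at most one arc between two vertices). For a digraph $D$ and $v\in V(D)$, $N^+(v)=\{u: vu\in A(D)\}$. A dominator coloring of $D$ is a partition of $V(D)$ into color classes such that (i) it is a proper coloring of the underlying graph (adjacent vertices receive different colors), and (ii) every vertex $v$ with at least one out-neighbor dominates some color class, i.e., there is a color class $C$ with $C\subseteq N^+(v)$; vertices of out-degree $0$ are not required to dominate anything. $\chi_d(D)$ is the minimum number of color classes in a dominator coloring of $D$. *)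

(* Defs.v *)
From mathcomp Require Import all_boot.

Set Implicit Arguments.
Unset Strict Implicit.
Unset Printing Implicit Defensive.

(* A simple graph on T is a symmetric irreflexive e : rel T; a digraph on T is
   given by its arc set A : {set T * T}, where (u, v) \in A is the arc u -> v. *)

Section DominatorColoring.

Variable T : finType.
Implicit Types (e : rel T) (A : {set T * T}) (P : {set {set T}}) (u v : T).

(* The case u = v of the second conjunct excludes loops. *)
Definition orientation e A : bool :=
  [forall u, forall v,
    (e u v == ((u, v) \in A) || ((v, u) \in A)) &&
    ~~ (((u, v) \in A) && ((v, u) \in A))].

Definition out_nbrs A v : {set T} := [set u | (v, u) \in A].

Definition proper_coloring A P : bool :=
  partition P [set: T] &&
  [forall C in P, forall u in C, forall v in C, (u, v) \notin A].

Definition dominates A P v : bool := [exists C in P, C \subset out_nbrs A v].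

Definition dominator_coloring A P : bool :=
  proper_coloring A P &&
  [forall v, (out_nbrs A v != set0) ==> dominates A P v].

Definition singletons : {set {set T}} := [set [set v] | v : T].

Lemma singletons_dominator A :
  (forall v, (v, v) \notin A) -> dominator_coloring A singletons.
Proof.
move=> loopless; apply/andP; split; first (apply/andP; split).
- apply/and3P; split.
  + apply/eqP/setP=> x; rewrite inE; apply/bigcupP.
    by exists [set x]; rewrite ?set11 // imset_f.
  + apply/trivIsetP=> _ _ /imsetP[x _ ->] /imsetP[y _ ->] neq.
    by rewrite disjoints1 inE; apply: contraNneq neq => ->.
  + by apply/imsetP=> -[x _ /setP/(_ x)]; rewrite !inE eqxx.
- apply/forall_inP=> _ /imsetP[x _ ->].
  apply/forall_inP=> u /set1P ->; apply/forall_inP=> v /set1P ->.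
  exact: loopless.
- apply/forallP=> v; apply/implyP=> /set0Pn[u uv].
  by apply/exists_inP; exists [set u]; rewrite ?imset_f // sub1set.
Qed.

(* The default value is admissible when A is loopless, by the lemma above;
   chi_d is junk otherwise, as no proper coloring exists then. *)
Definition chi_d A : nat :=
  #|[arg min_(P < singletons | dominator_coloring A P) #|P| ]|.

Lemma chi_dP A : (forall v, (v, v) \notin A) ->
  (exists2 P, dominator_coloring A P & #|P| = chi_d A) /\
  (forall P, dominator_coloring A P -> chi_d A <= #|P|).
Proof.
move=> /singletons_dominator sA; rewrite /chi_d.
by case: arg_minnP => // P dP minP; split=> //; exists P.
Qed.

Definition std_orientation e : {set T * T} :=
  [set p | e p.1 p.2 && (enum_rank p.1 < enum_rank p.2)].

Lemma std_orientationP e :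
  symmetric e -> irreflexive e -> orientation e (std_orientation e).
Proof.
move=> sym irr; apply/forallP=> u; apply/forallP=> v.
rewrite !inE /= (sym v u).
case: (ltngtP (enum_rank u) (enum_rank v)) => [||/val_inj/enum_rank_inj ->];
  by rewrite ?irr //; case: (e u v).
Qed.

(* Minimum over all orientations; again the default is itself an orientation
   as soon as e is a simple graph. *)
Definition chi_d_min e : nat :=
  chi_d [arg min_(A < std_orientation e | orientation e A) chi_d A].

Lemma chi_d_minP e : symmetric e -> irreflexive e ->
  (exists2 A, orientation e A & chi_d A = chi_d_min e) /\
  (forall A, orientation e A -> chi_d_min e <= chi_d A).
Proof.
move=> sym irr; rewrite /chi_d_min.
case: arg_minnP => [|A oA minA]; first exact: std_orientationP.
by split=> //; exists A.
Qed.

End DominatorColoring.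

Definition path_graph (n : nat) : rel 'I_n :=
  fun i j => (i.+1 == j :> nat) || (j.+1 == i :> nat).
Arguments path_graph : clear implicits.

Lemma path_graph_sym n : symmetric (path_graph n).
Proof. by move=> i j; rewrite /path_graph orbC. Qed.

Lemma path_graph_irr n : irreflexive (path_graph n).
Proof. by move=> i; rewrite /path_graph gtn_eqF. Qed.

(* Main.v *)
Require Import Defs.
From mathcomp Require Import all_boot.
From mathcomp Require Import zify.

(** Let N be the set of vertices of positive out-degree and choose for each of
    them a dominated class.  A class C chosen by g vertices spans a complete
    bipartite subgraph of the path, so g + |C| <= 3 and g <= 2.  The vertices
    outside N are independent, so |N| is at least the integer part of n / 2;
    with d chosen classes this gives |N| <= 2 d, and the chosen classes cover at
    most 3 d - |N| vertices.  Only when at most one further class exists is this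
    not enough: that class is independent, and the counting bounds n again,
    except on P_4 and P_7, which are settled by hand.
    The bound is attained by orienting each edge from its odd to its even end,
    with one colour on the odd vertices, singleton classes at the vertices
    congruent to 2 modulo 4, and one colour on the other even vertices. *)

(** * Independent sets, neighbourhoods and bicliques in a path *)

(** Halving is injective on [I]: distinct vertices with equal halves are adjacent. *)
Lemma path_graph_indep_card n (I : {set 'I_n}) :
  {in I &, forall u v, ~~ path_graph n u v} -> #|I| <= uphalf n.
Proof.
move=> indI.
have half_lt (i : 'I_n) : i./2 < uphalf n by have := ltn_ord i; lia.
pose h i : 'I_(uphalf n) := Ordinal (half_lt i).
rewrite -[uphalf n]card_ord -(@card_in_imset _ _ h) ?max_card //.
move=> u v uI vI /(congr1 val) /= uv; apply: val_inj => /=.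
have := indI u v uI vI; rewrite /path_graph; lia.
Qed.

(* An even vertex outside I would leave two even paths, on which I contains at
   most half of the vertices. *)
Lemma path_graph_max_indep n m (I : {set 'I_n}) :
  n = m.*2.+1 -> {in I &, forall u v, ~~ path_graph n u v} -> m < #|I| ->
  forall v : 'I_n, ~~ odd v -> v \in I.
Proof.
move=> nE indI cardI v evv; apply: contraLR cardI => vI; rewrite -leqNgt.
have neqv u : u \in I -> u <> v :> nat.
  by move=> uI /val_inj uv; rewrite -uv uI in vI.
(* The pairs are {2i, 2i+1} below [v] and {2i+1, 2i+2} above it; they cover all vertices but [v]. *)
have h_lt (u : 'I_n) : u \in I -> (if u < v then u./2 else u.-1./2) < m.
  by move=> /neqv; have := ltn_ord u; have := ltn_ord v; case: ifP; lia.
rewrite -[m]card_ord -card_sig.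
apply: (@leq_card _ _ (fun u => Ordinal (h_lt _ (valP u)))).
move=> [u uI] [w wI] /(congr1 val) /= uw; apply/val_inj/val_inj => /=.
have := neqv u uI; have := neqv w wI; have := indI u w uI wI.
by rewrite /path_graph; move: uw; do 2 case: ifP; lia.
Qed.

Lemma path_graph_degree n (v : 'I_n) (X : {set 'I_n}) :
  {in X, forall u, path_graph n v u} -> #|X| <= 2.
Proof.
move=> adj; rewrite -card_bool -(@card_in_imset _ _ (fun u : 'I_n => u < v)).
  exact: max_card.
move=> u w uX wX /= uw; apply: val_inj => /=.
by have := adj u uX; have := adj w wX; move: uw; rewrite /path_graph; lia.
Qed.

(** Each side has at most two vertices by the degree bound, and two on both sides would form a
    4-cycle. *)
Lemma path_graph_biclique n (X Y : {set 'I_n}) :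
  X != set0 -> Y != set0 ->
  {in X & Y, forall u v, path_graph n u v} -> #|X| + #|Y| <= 3.
Proof.
move=> /set0Pn[x xX] /set0Pn[y yY] adj.
have X2 : #|X| <= 2.
  by apply: (path_graph_degree _ y) => u uX; rewrite path_graph_sym adj.
have Y2 : #|Y| <= 2 by apply: (path_graph_degree _ x) => u uY; exact: adj.
have [|X1] := leqP #|X| 1; first lia.
have [|Y1] := leqP #|Y| 1; first lia.
have /card_gt1P[x1 [x2 [x1X x2X /eqP x12]]] := X1.
have /card_gt1P[y1 [y2 [y1Y y2Y /eqP y12]]] := Y1.
have := adj _ _ x1X y1Y; have := adj _ _ x1X y2Y.
have := adj _ _ x2X y1Y; have := adj _ _ x2X y2Y.
have : x1 <> x2 :> nat by move/val_inj.
have : y1 <> y2 :> nat by move/val_inj.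
by rewrite /path_graph; lia.
Qed.

(** * Lower bound: counting chosen and unchosen classes *)

Section LowerBound.

Variables (n : nat) (A : {set 'I_n * 'I_n}) (P : {set {set 'I_n}}).
Hypothesis orA : orientation (path_graph n) A.
Hypothesis domP : dominator_coloring A P.

Let adjE u v : path_graph n u v = ((u, v) \in A) || ((v, u) \in A).
Proof. by have /forallP/(_ u)/forallP/(_ v)/andP[/eqP] := orA. Qed.

Let arc_asym u v : (u, v) \in A -> (v, u) \in A -> False.
Proof.
by have /forallP/(_ u)/forallP/(_ v)/andP[_] := orA; case: (_ \in A) => //= /negP.
Qed.

Let partP : partition P [set: 'I_n].
Proof. by case/andP: domP => /andP[]. Qed.

Let class_indep C : C \in P -> {in C &, forall u v, ~~ path_graph n u v}.
Proof.
move=> CP u v uC vC; case/andP: domP => /andP[_ /forall_inP/(_ C CP)/forall_inP H] _.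
rewrite adjE negb_or.
by have /forall_inP/(_ v vC)-> := H u uC; have /forall_inP/(_ u uC)-> := H v vC.
Qed.

Let same_class C1 C2 u : C1 \in P -> C2 \in P -> u \in C1 -> u \in C2 -> C1 = C2.
Proof.
case/and3P: partP => _ tP _ C1P C2P uC1 uC2.
by rewrite -(def_pblock tP C1P uC1) (def_pblock tP C2P uC2).
Qed.

Let class_neq0 C : C \in P -> C != set0.
Proof. by case/and3P: partP => _ _ P0 CP; apply: contraNneq P0 => <-. Qed.

Let N : {set 'I_n} := [set v | out_nbrs A v != set0].

(** The default [set0] never occurs for [v] in [N], since such a vertex dominates a class. *)
Let pick_class v : {set 'I_n} :=
  odflt set0 [pick C | (C \in P) && (C \subset out_nbrs A v)].

Let pick_classP v : v \in N ->
  pick_class v \in P /\ {in pick_class v, forall u, (v, u) \in A}.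
Proof.
rewrite inE => vN; case/andP: domP => _ /forallP/(_ v)/implyP/(_ vN)/exists_inP.
case=> C CP Cv; rewrite /pick_class.
case: pickP => [D /andP[DP /subsetP Dv] /=|/(_ C)]; last by rewrite CP Cv.
by split=> // u /Dv; rewrite inE.
Qed.

Let D := pick_class @: N.

Let sub_DP : D \subset P.
Proof. by apply/subsetP=> _ /imsetP[v /pick_classP[vP _] ->]. Qed.

Let sinks_indep : {in ~: N &, forall u v, ~~ path_graph n u v}.
Proof.
move=> u v; rewrite !inE !negbK adjE => /eqP uN /eqP vN; rewrite negb_or.
by move/setP: uN => /(_ v); move/setP: vN => /(_ u); rewrite !inE => -> ->.
Qed.

Let card_N_ge : n./2 <= #|N|.
Proof.
have := path_graph_indep_card _ _ sinks_indep.
by have := cardsC N; rewrite card_ord; lia.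
Qed.

Let fibre C := [set v in N | pick_class v == C].

Let fibre_adj C : {in fibre C & C, forall v u, path_graph n v u}.
Proof.
move=> v u; rewrite inE => /andP[/pick_classP[_ H] /eqP vC] uC.
by rewrite adjE H // vC.
Qed.

Let fibre_card C : C \in D -> #|fibre C| + #|C| <= 3 /\ #|fibre C| <= 2.
Proof.
move=> CD; have C0 := class_neq0 _ (subsetP sub_DP C CD).
have := @path_graph_biclique _ (fibre C) C.
case: (imsetP CD) => v vN vC H.
have {}H : #|fibre C| + #|C| <= 3.
  apply: H => //.
  by apply/set0Pn; exists v; rewrite inE vN vC eqxx.
by move: C0; rewrite -card_gt0; lia.
Qed.

Let card_N : #|N| = \sum_(C in D) #|fibre C|.
Proof.
rewrite -sum1_card (partition_big_imset pick_class) /=.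
by apply: eq_bigr => C _; rewrite -sum1_card; apply: eq_bigl => v; rewrite !inE.
Qed.

Let card_N_le : #|N| <= 2 * #|D|.
Proof.
rewrite card_N mulnC -sum_nat_const; apply: leq_sum => C CD.
by case: (fibre_card C CD).
Qed.

Let card_N_cover : #|N| + \sum_(C in D) #|C| <= 3 * #|D|.
Proof.
rewrite card_N mulnC -sum_nat_const -big_split; apply: leq_sum => C CD.
by case: (fibre_card C CD).
Qed.

Let card_cover : n = \sum_(C in D) #|C| + \sum_(C in P :\: D) #|C|.
Proof.
rewrite -[LHS]card_ord -cardsT (card_partition partP).
rewrite (big_setID D) /=; congr (_ + _); apply: eq_bigl => C.
by rewrite (setIidPr sub_DP).
Qed.

Let card_P : #|P| = #|D| + #|P :\: D|.
Proof. by rewrite -(cardsID D P) (setIidPr sub_DP). Qed.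

Let few_other_classes :
  [\/ 2 <= #|P :\: D|,
      exists2 R, P :\: D = [set R] & R \in P /\ #|R| <= uphalf n
    | P :\: D = set0].
Proof.
case E: #|P :\: D| => [|[|r]]; last by constructor 1.
  by constructor 3; apply/eqP; rewrite -cards_eq0 E.
constructor 2; have /cards1P[R PR] : #|P :\: D| == 1 by rewrite E.
have RP : R \in P by have := set11 R; rewrite -PR inE => /andP[].
exists R => //; split=> //; exact/path_graph_indep_card/class_indep.
Qed.

(* With two classes {0, 2} and {1, 3}, both end vertices must be sinks, and then
   1 and 2 can only dominate the opposite class, which needs both arcs between
   them. *)
Lemma dominator_coloring_path4 : n = 4 -> 3 <= #|P|.
Proof.
move=> n4; rewrite ltnNge; apply/negP => P2.
have lt i : i < 4 -> i < n by rewrite n4.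
pose v i (Hi : i < 4) : 'I_n := Ordinal (lt i Hi).
pose v0 := v 0 isT; pose v1 := v 1 isT; pose v2 := v 2 isT; pose v3 := v 3 isT.
pose c u := pblock P u.
have covP u : u \in cover P by rewrite (cover_partition partP).
have cP u : c u \in P by rewrite pblock_mem.
have uc u : u \in c u by rewrite mem_pblock.
have c_neq u w : path_graph n u w -> c u != c w.
  move=> uw; apply: contraL uw => /eqP uw.
  by apply: (class_indep (c u)) => //; rewrite uw.
have two u w z : path_graph n u w -> path_graph n w z -> c u = c z.
  move=> /c_neq uw /c_neq wz; apply/eqP; apply: contraLR P2 => uz.
  by rewrite -ltnNge; apply/card_gt2P; exists (c u), (c w), (c z); split=> //;
     split=> //; rewrite eq_sym.
have c02 : c v0 = c v2 by apply: (two _ v1).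
have c13 : c v1 = c v3 by apply: (two _ v2).
(* The class dominated by [u] is nonempty and consists of neighbours of [u]; if these all share the
   class of [x], it is that class. *)
have dom u w : (u, w) \in A -> forall x, path_graph n u x ->
    (forall y, path_graph n u y -> c y = c x) -> {in c x, forall y, (u, y) \in A}.
  move=> uw x ux all_x.
  have /pick_classP[CP Cu] : u \in N by rewrite inE; apply/set0Pn; exists w; rewrite inE.
  have /set0Pn[y yC] := class_neq0 _ CP.
  have uy : path_graph n u y by rewrite adjE (Cu y yC).
  by rewrite -(all_x y uy) /c (def_pblock _ CP yC) //; case/and3P: partP.
have v10 : (v1, v0) \in A.
  have : path_graph n v0 v1 by [].
  rewrite adjE => /orP[v01|//].
  have : (v0, v3) \in A.
    apply: (dom v0 v1 v01 v1) => //; last by rewrite c13.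
    by move=> y Hy; congr c; apply: val_inj; move: Hy; rewrite /path_graph /=; lia.
  by move=> v03; have := adjE v0 v3; rewrite v03.
have v23 : (v2, v3) \in A.
  have : path_graph n v2 v3 by [].
  rewrite adjE => /orP[//|v32].
  have : (v3, v0) \in A.
    apply: (dom v3 v2 v32 v2) => //; last by rewrite -c02.
    by move=> y Hy; congr c; apply: val_inj; move: Hy (ltn_ord y); rewrite /path_graph /=; lia.
  by move=> v30; have := adjE v3 v0; rewrite v30.
apply: (@arc_asym v1 v2).
  apply: (dom v1 v0 v10 v0) => //; last by rewrite c02.
  by move=> y Hy; apply: (two _ v1) => //; rewrite path_graph_sym.
apply: (dom v2 v3 v23 v3) => //; last by rewrite -c13.
by move=> y Hy; apply: (two _ v2) => //; rewrite path_graph_sym.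
Qed.

(* Both the sinks and R contain every even vertex, so an odd vertex can only
   dominate R itself. *)
Let single_other_class m R :
  n = m.*2.+1 -> P :\: D = [set R] -> m < #|R| -> #|N| <= m -> N = set0.
Proof.
move=> nE DR cardR cardN.
have /setDP[RP RD] : R \in P :\: D by rewrite DR set11.
have evR := path_graph_max_indep _ _ _ nE (class_indep _ RP) cardR.
have evS (v : 'I_n) : ~~ odd v -> v \in ~: N.
  apply: (path_graph_max_indep _ _ _ nE sinks_indep).
  by have := cardsC N; rewrite card_ord; lia.
apply/eqP/set0Pn => -[v vN]; have [CP Cv] := pick_classP _ vN.
have oddv : odd v by apply: contraLR vN => /evS; rewrite inE.
have /set0Pn[u uC] := class_neq0 _ CP.
have evu : ~~ odd u.
  by have := adjE v u; rewrite (Cv u uC) /path_graph; move: oddv; lia.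
by move: RD; rewrite -(same_class _ _ _ CP RP uC (evR u evu)) imset_f.
Qed.

(** With d = [#|D|], the counts give [n./2] <= 2d in general, 2 * [n./2] <= 3d if one class is
    unchosen, and n + [n./2] <= 3d if none is. *)
Lemma dominator_coloring_path_ge k : 0 < k ->
  [/\ n = 4 * k -> k + 2 <= #|P|,
      n = 4 * k + 1 -> k + 2 <= #|P|,
      n = 6 -> 3 <= #|P|,
      n = 4 * k + 2 -> 1 < k -> k + 3 <= #|P|
    & n = 4 * k + 3 -> k + 3 <= #|P|].
Proof.
move=> k_gt0; have := card_N_ge; have := card_N_le; have := card_N_cover.
have := card_cover; have := card_P.
case: few_other_classes => [||DP].
- by split; lia.
- case=> R DR [RP cardR]; rewrite DR cards1 big_set1.
  have [k1|k1] := leqP k 1; last by split; lia.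
  (* Counting leaves only [n = 7] with at most three classes, where equality forces [#|R| = 4] and
     [#|N| = 3]. *)
  have := single_other_class 3 R; rewrite DR => sR.
  split; try lia.
  move=> n7; rewrite leqNgt; apply/negP => P4.
  have N0 : N = set0 by apply: sR => //; lia.
  by have := card_N_ge; rewrite N0 cards0; lia.
(* Here counting fails only for [n = 4]. *)
- rewrite DP cards0 big_set0; have := dominator_coloring_path4.
  by split; lia.
Qed.

End LowerBound.

(** * Upper bound: explicit colourings *)

Definition odd_to_even n : {set 'I_n * 'I_n} :=
  [set p | path_graph n p.1 p.2 && odd p.1].

Lemma odd_to_even_orientation n : orientation (path_graph n) (odd_to_even n).
Proof.
apply/forallP=> u; apply/forallP=> v; rewrite !inE /= /path_graph; lia.
Qed.

Lemma chi_d_min_path_le n m (c : nat -> nat) :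
  (forall i, i < n -> c i < m) ->
  (forall i, i.+1 < n -> c i != c i.+1) ->
  (forall i, i < n -> odd i -> exists2 j, j < n &
     forall l, l < n -> c l = c j -> (i.+1 == l) || (l.+1 == i)) ->
  chi_d_min (path_graph n) <= m.
Proof.
move=> c_lt c_proper c_dom.
apply: (@leq_trans (chi_d (odd_to_even n))).
  have [_] := chi_d_minP (@path_graph_sym n) (@path_graph_irr n); apply.
  exact: odd_to_even_orientation.
pose P := preim_partition (fun i : 'I_n => c i) [set: 'I_n].
have partP : partition P [set: 'I_n] := preim_partitionP _ _.
have classE (C : {set 'I_n}) u v : C \in P -> u \in C -> (v \in C) = (c v == c u).
  move=> /imsetP[x _ ->]; rewrite !inE /= => /eqP ->.
  by rewrite eq_sym.
have cardP : #|P| <= m.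
  have -> : P = [set [set v : 'I_n | c v == i] | i : 'I_m in
                  [set Ordinal (c_lt u (ltn_ord u)) | u : 'I_n]].
    rewrite -imset_comp; apply/setP=> C; apply/imsetP/imsetP => -[x _ ->];
      by exists x => //; apply/setP=> v; rewrite !inE /= eq_sym.
  by rewrite (leq_trans (leq_imset_card _ _)) // (leq_trans (max_card _)) ?card_ord.
apply: leq_trans cardP; have [v|_] := @chi_dP _ (odd_to_even n).
  by rewrite inE /= path_graph_irr.
apply.
apply/andP; split; first (apply/andP; split=> //).
  apply/forall_inP=> C CP; apply/forall_inP=> u uC; apply/forall_inP=> v vC.
  have := classE C u v CP uC; rewrite vC inE /= /path_graph => /esym/eqP cvu.
  apply/negP=> /andP[/orP[/eqP uv|/eqP uv] _].
    by have := c_proper u; rewrite uv ltn_ord cvu eqxx => /(_ isT).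
  by have := c_proper v; rewrite uv ltn_ord cvu eqxx => /(_ isT).
apply/forallP=> v; apply/implyP=> /set0Pn[w]; rewrite !inE /= => /andP[_ oddv].
have [j lt_j Hj] := c_dom v (ltn_ord v) oddv.
apply/exists_inP; exists (pblock P (Ordinal lt_j)).
  by rewrite pblock_mem // (cover_partition partP).
apply/subsetP=> u.
rewrite (classE _ (Ordinal lt_j)) ?pblock_mem ?mem_pblock ?(cover_partition partP) //.
by move=> /eqP /(Hj u (ltn_ord u)) vu; rewrite !inE /= oddv andbT.
Qed.

(* The clause [i.+2 == n] is only relevant for n = 4 k + 2, where the last
   vertex 4 k + 1 has no neighbour congruent to 2 modulo 4. *)
Definition path_color n i : nat :=
  if odd i then 0 else if (i %% 4 == 2) || (i.+2 == n) then 2 + i %/ 4 else 1.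

Lemma path_color_chi_d_min n m : 0 < n ->
  (forall i, i < n -> path_color n i < m) -> chi_d_min (path_graph n) <= m.
Proof.
move=> n_gt0 c_lt; apply: (chi_d_min_path_le _ _ (path_color n)) => //.
  by move=> i _; rewrite /path_color; do !case: ifP; lia.
move=> i lt_in oddi.
(* This vertex is alone in its class: it is 2 modulo 4, or it is [n - 2] when [i] is the last vertex
   and 1 modulo 4. *)
exists (if (i %% 4 == 1) && (i.+1 < n) then i.+1 else i.-1); first by case: ifP; lia.
by move=> l lt_ln; rewrite /path_color; do !case: ifP; lia.
Qed.

(** [path_color] would use four colours. Here {0, 2} is dominated by 1, and {4} by 3 and 5. *)
Lemma chi_d_min_path6_le : chi_d_min (path_graph 6) <= 3.
Proof.
apply: (chi_d_min_path_le _ _ (fun i => if odd i then 0 else if i < 4 then 1 else 2)).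
- by move=> i _; do !case: ifP.
- by move=> i _; do !case: ifP; lia.
move=> i lt_i6 oddi; exists (if i < 2 then 0 else 4); first by case: ifP.
by case: ltnP => lt_i2 l lt_l6 /=; do !case: ifP; lia.
Qed.

Lemma chi_d_min_path_ge n m :
  (forall A P, orientation (path_graph n) A -> dominator_coloring A P -> m <= #|P|) ->
  m <= chi_d_min (path_graph n).
Proof.
move=> H; have [[A orA <-] _] := chi_d_minP (@path_graph_sym n) (@path_graph_irr n).
have [|[P domP <-] _] := @chi_dP _ A; last exact: H orA domP.
by move=> v; have /forallP/(_ v)/forallP/(_ v)/andP[_] := orA; rewrite andbb.
Qed.

Theorem theorem1 :
  (forall k : nat, 1 <= k ->
     [/\ chi_d_min (path_graph (4 * k)) = k + 2,
         chi_d_min (path_graph (4 * k + 1)) = k + 2,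
         (4 * k + 2 <> 6 -> chi_d_min (path_graph (4 * k + 2)) = k + 3)
       & chi_d_min (path_graph (4 * k + 3)) = k + 3])
  /\ chi_d_min (path_graph 6) = 3.
Proof.
split=> [k k_gt0|].
  split=> [||n6|]; apply/eqP; rewrite eqn_leq; apply/andP; split;
    try (by apply: path_color_chi_d_min => [|i]; rewrite /path_color;
            do ?case: ifP; lia);
    apply: chi_d_min_path_ge => A P orA domP;
    have [H0 H1 _ H2 H3] := dominator_coloring_path_ge _ _ _ orA domP _ k_gt0.
  + exact: H0.
  + exact: H1.
  + by apply: H2 => //; lia.
  + exact: H3.
apply/eqP; rewrite eqn_leq chi_d_min_path6_le.
apply: chi_d_min_path_ge => A P orA domP.
by have [_ _ H _ _] := dominator_coloring_path_ge _ _ _ orA domP _ (ltn0Sn 0); apply: H.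
Qed.
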